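(* Let $B$ be a Chomp board, i.e. a finite set of cells $(x,y)$ with $x,y$ positive integers such that whenever $(x,y)\in B$, $1\le p\le x$ and $1\le q\le y$, also $(p,q)\in B$. Play random Chomp starting from $B$: on each turn the player to move selects a cell $(x,y)$ of the current board uniformly at random, independently of previous turns, and removes every cell $(p,q)$ with $p\ge x$ and $q\ge y$; the game ends when the board is empty. Then the expected number of turns is \[ \mathbb{E}[\text{number of turns starting from } B] = \sum_{(x,y)\in B}\frac{1}{xy}. \] In particular, if $B$ is the $m\times n$ rectangle $\{(x,y):1\le x\le m,\ 1\le y\le n\}$, the expected number of turns is $\left(\sum_{j=1}^m \frac1j\right)\left(\sum_{j=1}^n\frac1j\right)$.
   Context: A cell $(x,y)$ lies in row $x$ and column $y$, with $(1,1)$ the top-left cell. The game ends when the cell $(1,1)$ is chomped (the board then becomes empty). For the empty board the number of turns is $0$. *)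

(* Defs.v *)
From HB Require Import structures.
From mathcomp Require Import all_boot all_order all_algebra finmap.
From mathcomp Require Import all_classical all_reals all_analysis.

Set Implicit Arguments.
Unset Strict Implicit.
Unset Printing Implicit Defensive.

Import Order.TTheory GRing.Theory Num.Theory.

Local Open Scope fset_scope.
Local Open Scope classical_set_scope.
Local Open Scope ring_scope.

Notation cell := (nat * nat)%type.

Definition chomp_board (B : {fset cell}) : Prop :=
  (forall x y : nat, (x, y) \in B -> (0 < x)%N /\ (0 < y)%N) /\
  (forall x y p q : nat, (x, y) \in B ->
     (1 <= p <= x)%N -> (1 <= q <= y)%N -> (p, q) \in B).

Definition chomp (B : {fset cell}) (c : cell) : {fset cell} :=
  [fset p in B | ~~ ((c.1 <= p.1)%N && (c.2 <= p.2)%N)].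

(* Turns are numbered from 0, and [c s] is the cell selected on turn [s]. *)
Fixpoint board_after (B : {fset cell}) (c : nat -> cell) (t : nat) :=
  if t is s.+1 then chomp (board_after B c s) (c s) else B.

(* The first time at which the board is empty; +oo if the game never ends. *)
Definition turns (R : realType) (B : {fset cell}) (c : nat -> cell) : \bar R :=
  ereal_inf [set (t%:R)%:E | t in [set t | board_after B c t = fset0]].

(* [X t] is the cell selected on turn [t].  For every sequence [h] of the first
   [t] selections (only [h 0], ..., [h t.-1] matter) after which the game is
   not over, the conditional law of [X t] given this history is uniform on the
   current board.  This is written in product form, hence is vacuous for
   histories of probability 0.  Nothing is asked of [X t] once the board is
   empty. *)
Definition random_chomp d (Omega : measurableType d) (R : realType)
    (P : probability Omega R) (B : {fset cell})
    (X : nat -> {RV P >-> cell}) : Prop :=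
  forall (t : nat) (h : nat -> cell) (c : cell),
    let past := [set w | forall s, (s < t)%N -> X s w = h s] in
    let Bt := board_after B h t in
    Bt != fset0 ->
    (P (past `&` X t @^-1` [set c]) =
     P past * ((c \in Bt)%:R / #|` Bt|%:R)%:E)%E.

Definition expected_turns d (Omega : measurableType d) (R : realType)
    (P : probability Omega R) (B : {fset cell})
    (X : nat -> {RV P >-> cell}) : \bar R :=
  (\int[P]_w turns R B (fun t => X t w))%E.

Definition rectangle (m n : nat) : {fset cell} :=
  [fset c | c in [seq (x, y) | x <- iota 1 m, y <- iota 1 n]].

(* Main.v *)
(* Put f(B) = sum over B of 1/(xy).  Double counting shows that a uniform move
   from a nonempty board B lowers f by exactly 1 on average.  Hence, on the
   event that the first t moves follow a history h leading to the board B_t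
   without ending the game earlier, the number of turns averages t + f(B_t): by
   induction on #|B_t|, splitting the event according to the next move.  The
   theorem is the case t = 0. *)
Require Import Defs.
From HB Require Import structures.
From mathcomp Require Import all_boot all_order all_algebra finmap.
From mathcomp Require Import all_classical all_reals all_analysis.
From mathcomp Require Import measurable_realfun.

Set Implicit Arguments.
Unset Strict Implicit.
Unset Printing Implicit Defensive.

Import Order.TTheory GRing.Theory Num.Theory.

Local Open Scope fset_scope.
Local Open Scope classical_set_scope.
Local Open Scope ring_scope.

(** * Boards, moves and rectangles *)

Lemma in_chomp (B : {fset cell}) (c p : cell) :
  (p \in chomp B c) = (p \in B) && ~~ ((c.1 <= p.1)%N && (c.2 <= p.2)%N).
Proof. by rewrite !inE. Qed.

Lemma chomp_board_chomp (B : {fset cell}) (c : cell) :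
  chomp_board B -> chomp_board (chomp B c).
Proof.
move=> [posB downB]; split=> [x y|x y p q]; rewrite !in_chomp /=.
  by case/andP=> /posB.
case/andP=> xyB nc px qy; rewrite (downB _ _ _ _ xyB px qy) /=.
case/andP: px => _ px; case/andP: qy => _ qy.
apply: contra nc => /andP[cp cq].
by rewrite (leq_trans cp px) (leq_trans cq qy).
Qed.

(** The chosen cell removes itself. This drop drives the induction on the size of the board. *)
Lemma card_chomp_lt (B : {fset cell}) (c : cell) :
  c \in B -> (#|` chomp B c| < #|` B|)%N.
Proof.
move=> cB; apply: fproper_ltn_card; rewrite /fproper fset_sub /=.
by apply/fsubsetPn; exists c => //; rewrite in_chomp !leqnn andbF.
Qed.

Lemma perm_rectangle (m n : nat) :
  perm_eq (rectangle m n) [seq (x, y) | x <- iota 1 m, y <- iota 1 n].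
Proof.
apply: uniq_perm; first exact: fset_uniq.
  by apply: allpairs_uniq; rewrite ?iota_uniq // => -[? ?] [? ?].
by move=> c; rewrite !inE.
Qed.

Lemma in_rectangle (m n : nat) (c : cell) :
  (c \in rectangle m n) = (1 <= c.1 <= m)%N && (1 <= c.2 <= n)%N.
Proof.
rewrite (perm_mem (perm_rectangle m n)); case: c => x y /=.
have in_iota1 k i : (i \in iota 1 k) = (1 <= i <= k)%N.
  by rewrite mem_iota add1n ltnS.
rewrite -!in_iota1.
apply/allpairsP/andP => [[[p q] [/= pm qn [-> ->]]] //|[xm yn]].
by exists (x, y).
Qed.

Lemma big_rectangle (R : nmodType) (m n : nat) (F : cell -> R) :
  \sum_(c <- rectangle m n) F c =
  \sum_(1 <= x < m.+1) \sum_(1 <= y < n.+1) F (x, y).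
Proof.
by rewrite (perm_big _ (perm_rectangle m n)) big_allpairs /index_iota !subn1.
Qed.

Lemma card_rectangle (m n : nat) : #|` rectangle m n| = (m * n)%N.
Proof.
by rewrite (perm_size (perm_rectangle m n)) size_allpairs !size_iota.
Qed.

(** * Averaging the harmonic sum over a move *)

Lemma sumr_fset_const (V : nmodType) (K : choiceType) (B : {fset K}) (x : V) :
  \sum_(c <- B) x = x *+ #|` B|.
Proof. by rewrite big_const_seq count_predT iter_addr_0. Qed.

(** Since [B] is closed downwards, the cells summed over fill the whole [p.1] by [p.2] rectangle,
    and the summand is the inverse of its area. *)
Lemma sum_below (R : realType) (B : {fset cell}) (p : cell) :
  chomp_board B -> p \in B ->
  \sum_(c <- B | (c.1 <= p.1)%N && (c.2 <= p.2)%N) (p.1%:R * p.2%:R)^-1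
  = 1 :> R.
Proof.
case: p => x y [posB downB] xyB /=.
rewrite big_fset_condE /= (_ : [fset _ in _ | _] = rectangle x y); last first.
  apply/fsetP => -[p q]; rewrite in_rectangle !inE /=.
  apply/andP/andP => [[/posB[-> ->] /andP[-> ->]]//|[px qy]].
  rewrite (downB _ _ _ _ xyB px qy).
  by case/andP: px => _ ->; case/andP: qy => _ ->.
have [x0 y0] := posB _ _ xyB.
rewrite sumr_fset_const card_rectangle -natrM -[_^-1 *+ _]mulr_natl mulfV //.
by rewrite pnatr_eq0 -lt0n muln_gt0 x0.
Qed.

(* Double counting: [p] is removed by exactly the [p.1 * p.2] cells [c <= p]. *)
Lemma sum_harmonic_chomp (R : realType) (B : {fset cell}) :
  chomp_board B ->
  \sum_(c <- B) \sum_(p <- chomp B c) (p.1%:R * p.2%:R)^-1 =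
  #|` B|%:R * (\sum_(p <- B) (p.1%:R * p.2%:R)^-1 - 1) :> R.
Proof.
move=> bB; set f := fun p : cell => (p.1%:R * p.2%:R)^-1 : R.
rewrite mulrBr mulr1.
(* The sum over the surviving cells is the full sum minus the sum over the removed ones. *)
under eq_bigr => c _.
  rewrite -big_fset_condE /=.
  have -> : \sum_(p <- B | ~~ ((c.1 <= p.1)%N && (c.2 <= p.2)%N)) f p =
    \sum_(p <- B) f p -
    \sum_(p <- B | (c.1 <= p.1)%N && (c.2 <= p.2)%N) f p.
    rewrite [in X in _ = X - _](bigID (fun p : cell =>
      (c.1 <= p.1)%N && (c.2 <= p.2)%N)) /=.
    by rewrite addrAC subrr add0r.
  over.
rewrite sumrB [X in _ - X](exchange_big_dep xpredT) //=; congr (_ - _).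
  by rewrite sumr_fset_const mulr_natl.
rewrite (eq_big_seq (fun=> 1)) => [|p pB]; last exact: sum_below.
by rewrite sumr_fset_const.
Qed.

(** * Histories and the number of turns *)

Lemma eq_board_after (B : {fset cell}) (c c' : nat -> cell) (t : nat) :
  (forall s, (s < t)%N -> c s = c' s) -> board_after B c t = board_after B c' t.
Proof.
elim: t => //= t IH cc'; rewrite cc' // IH // => s st; apply: cc'.
exact: ltnW.
Qed.

Lemma chomp_board_after (B : {fset cell}) (c : nat -> cell) (t : nat) :
  chomp_board B -> chomp_board (board_after B c t).
Proof. by move=> bB; elim: t => //= t IH; apply: chomp_board_chomp. Qed.

Lemma turns_eq (R : realType) (B : {fset cell}) (c : nat -> cell) (t : nat) :
  (forall s, (s < t)%N -> board_after B c s != fset0) ->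
  board_after B c t = fset0 -> turns R B c = t%:R%:E.
Proof.
move=> before after; apply/eqP; rewrite eq_le; apply/andP; split.
  by apply: ereal_inf_lbound; exists t.
apply: le_ereal_inf_tmp => _ [s /= Bs <-]; rewrite lee_fin ler_nat leqNgt.
by apply/negP => /before; rewrite Bs eqxx.
Qed.

Lemma turns_ge0 (R : realType) (B : {fset cell}) (c : nat -> cell) :
  (0 <= turns R B c)%E.
Proof. by apply: le_ereal_inf_tmp => _ [s _ <-]; rewrite lee_fin. Qed.

Definition past d (Omega : measurableType d) (X : nat -> Omega -> cell)
    (t : nat) (h : nat -> cell) : set Omega :=
  [set w | forall s, (s < t)%N -> X s w = h s].

(** Only the entries up to index [t] are ever read; the constant tail is a dummy. *)
Definition extend (t : nat) (h : nat -> cell) (c : cell) : nat -> cell :=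
  fun s => if (s < t)%N then h s else c.

Lemma past_extend d (Omega : measurableType d) (X : nat -> Omega -> cell)
    (t : nat) (h : nat -> cell) (c : cell) :
  past X t.+1 (extend t h c) = past X t h `&` X t @^-1` [set c].
Proof.
rewrite /past /extend; apply/seteqP; split=> w /=.
  move=> Xw; split=> [s st|]; last by rewrite Xw // ltnn.
  by rewrite Xw ?st // ltnS ltnW.
move=> [Xs Xt] s; rewrite ltnS leq_eqVlt => /orP[/eqP->|st].
  by rewrite ltnn.
by rewrite st Xs.
Qed.

Lemma board_after_extend (B : {fset cell}) (t s : nat) (h : nat -> cell)
    (c : cell) :
  (s <= t)%N -> board_after B (extend t h c) s = board_after B h s.
Proof.
move=> st; apply: eq_board_after => u us.
by rewrite /extend (leq_trans us st).
Qed.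

(** * Measurability of events and of the number of turns *)

Section Measure.
Context (R : realType) (d : measure_display) (Omega : measurableType d).
Context (P : probability Omega R) (X : nat -> {RV P >-> cell}).

(** [cell] carries the product sigma-algebra, so a singleton is handled as a product of two
    singletons of [nat]. *)
Lemma measurable_choice (t : nat) (c : cell) :
  measurable (X t @^-1` [set c]).
Proof.
apply: measurable_funPTI; case: c => x y.
rewrite (_ : [set (x, y)] = [set x] `*` [set y]); first exact: measurableX.
by apply/seteqP; split=> [_ ->|[? ?] [/= -> ->]].
Qed.

Lemma measurable_past (t : nat) (h : nat -> cell) : measurable (past X t h).
Proof.
elim: t h => [|t IH] h.
  by rewrite (_ : past X 0 h = setT); [exact: measurableT|apply/seteqP; split].
rewrite (_ : past X t.+1 h = past X t h `&` X t @^-1` [set h t]).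
  by apply: measurableI => //; exact: measurable_choice.
apply/seteqP; split=> w /=.
  by move=> Xh; split=> [s st|]; apply: Xh => //; exact: ltnW.
by move=> [Xs Xt] s; rewrite ltnS leq_eqVlt => /orP[/eqP->|/Xs].
Qed.

(* Only countably many histories of length [t] exist, and each of them
   determines the board. *)
Lemma measurable_board_empty (B : {fset cell}) (t : nat) :
  measurable [set w | board_after B (X ^~ w) t = fset0].
Proof.
(* A list codes a history, padded with a dummy cell; lists of every length may be allowed because
   [seq cell] is countable. *)
pose h (l : seq cell) := nth (0%N, 0%N) l.
rewrite (_ : mkset _ = \bigcup_(l : seq cell)
   (if board_after B (h l) t == fset0 then past X t (h l) else set0)).
  apply: countable_bigcupT_measurable => [|l]; first exact: countableP.
  by case: ifP => _; [exact: measurable_past|exact: measurable0].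
apply/seteqP; split=> [w /= Bw|w [l _]].
  have hw s : (s < t)%N -> X s w = h (mkseq (X ^~ w) t) s.
    by move=> st; rewrite /h nth_mkseq.
  by exists (mkseq (X ^~ w) t) => //; rewrite -(eq_board_after _ hw) Bw eqxx.
case: ifP => // /eqP Bl Xl /=.
by rewrite -Bl; apply: eq_board_after.
Qed.

Lemma measurable_turns (B : {fset cell}) :
  measurable_fun setT (fun w => turns R B (X ^~ w)).
Proof.
(* The infimum over a set of times that varies with [w] becomes an infimum of a fixed sequence of
   functions: times with a nonempty board get the neutral value [+oo]. *)
pose g t w : \bar R :=
  if board_after B (X ^~ w) t == fset0 then t%:R%:E else +oo%E.
rewrite (_ : (fun _ => _) = fun w => einfs (g ^~ w) 0%N).
  apply: measurable_fun_einfs => t.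
  apply: measurable_fun_ifT => //.
  apply: (measurable_fun_bool true); rewrite setTI.
  rewrite (_ : _ @^-1` _ = [set w | board_after B (X ^~ w) t = fset0]).
    exact: measurable_board_empty.
  by apply/seteqP; split=> w /= /eqP.
apply/funext => w; rewrite /turns /einfs /sdrop /g.
apply/eqP; rewrite eq_le; apply/andP; split.
  apply: le_ereal_inf_tmp => _ [t _ <-]; case: ifP => [/eqP Bt|_].
    by apply: ereal_inf_lbound; exists t.
  by rewrite leey.
apply: le_ereal_inf_tmp => _ [t /= Bt <-]; apply: ereal_inf_lbound.
by exists t => //; rewrite Bt eqxx.
Qed.

(** * Expected number of turns along a history *)

Lemma prob_past_extend (B : {fset cell}) (t : nat) (h : nat -> cell)
    (c : cell) :
  random_chomp B X -> c \in board_after B h t ->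
  P (past X t.+1 (extend t h c)) =
  (P (past X t h) * (#|` board_after B h t|%:R^-1)%:E)%E.
Proof.
move=> hX cB; rewrite past_extend.
have Bt0 : board_after B h t != fset0 by apply/fset0Pn; exists c.
by have /= := hX t h c Bt0; rewrite cB mul1r.
Qed.

(** The legal continuations are disjoint and each takes an equal share [1 / #|Bt|] of the
    probability of the past, so together they exhaust it up to a null set. *)
Lemma integral_past_split (B : {fset cell}) (t : nat) (h : nat -> cell)
    (f : Omega -> \bar R) :
  random_chomp B X -> board_after B h t != fset0 ->
  measurable_fun setT f -> (forall w, 0 <= f w)%E ->
  (\int[P]_(w in past X t h) f w = \sum_(c <- board_after B h t)
     \int[P]_(w in past X t.+1 (extend t h c)) f w)%E.
Proof.
move=> hX Bt0 mf f0; set Bt := board_after B h t.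
pose F c := past X t.+1 (extend t h c).
have mF c : measurable (F c) by exact: measurable_past.
have tF : trivIset [set` Bt] F.
  rewrite (_ : F = fun c => past X t h `&` X t @^-1` [set c]).
    exact: trivIset_preimage1_in.
  by apply/funext => c; exact: past_extend.
(* Outside [U], the past may still contain outcomes where [X t] picks a cell off the board; these
   are shown to be negligible. *)
pose U := \big[setU/set0]_(c <- Bt) F c.
have mU : measurable U by apply: bigsetU_measurable.
have mp := measurable_past t h.
have mN : measurable (past X t h `\` U) by exact: measurableD.
have Up : U `<=` past X t h.
  rewrite /U -bigcup_fset => w [c _].
  by rewrite /F past_extend => -[].
have n0 : #|` Bt|%:R != 0 :> R by rewrite pnatr_eq0 cardfs_eq0.
have PU : P U = P (past X t h).
  rewrite /U measure_fbigsetU //.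
  rewrite (eq_big_seq (fun=> P (past X t h) * (#|` Bt|%:R^-1)%:E)%E); last first.
    by move=> c cB; exact: prob_past_extend.
  rewrite -(fineK (fin_num_measure P _ mp)) -EFinM sumEFin.
  by rewrite sumr_fset_const -[_ *+ _]mulr_natr mulfVK.
have PN : P (past X t h `\` U) = 0%E.
  have -> : P (past X t h `\` U) = (P (past X t h) - P (past X t h `&` U))%E.
    by apply: measureD => //; rewrite -ge0_fin_numE ?fin_num_measure.
  by rewrite (setIidr Up) PU subee ?fin_num_measure.
have mfD D : measurable_fun D f by exact: measurable_funTS.
rewrite -[in LHS](setDUK Up) ge0_integral_setU //; last first.
  by rewrite disj_set2E setDE setICA setICr setI0.
rewrite [X in (_ + X)%E]null_set_integral // adde0.
by rewrite ge0_integral_bigsetU.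
Qed.

(** Multiplying by the probability of the past replaces a conditional expectation and covers
    histories of probability 0. *)
Lemma integral_past_turns (B : {fset cell}) (t : nat) (h : nat -> cell) :
  chomp_board B -> random_chomp B X ->
  (forall s, (s < t)%N -> board_after B h s != fset0) ->
  (\int[P]_(w in past X t h) turns R B (X ^~ w) =
   P (past X t h) *
   (t%:R + \sum_(p <- board_after B h t) (p.1%:R * p.2%:R)^-1)%:E)%E.
Proof.
move=> bB hX; have [n] := ubnP #|` board_after B h t|.
elim: n t h => // n IH t h; rewrite ltnS => Bn before.
have mp := measurable_past t h.
have [Bt0|Bt0] := eqVneq (board_after B h t) fset0.
  (* The game ends exactly at time [t], so the integrand is constant on this event. *)
  rewrite Bt0 big_seq_fset0 addr0 muleC -integral_cst //.
  apply: eq_integral => w /[!inE] Xw /=; apply: turns_eq => [s st|].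
    rewrite (@eq_board_after _ _ h) ?before // => u us.
    by apply: Xw; exact: ltn_trans st.
  by rewrite -Bt0; exact: eq_board_after.
rewrite (integral_past_split hX Bt0) //; last 2 first.
- exact: measurable_turns.
- by move=> w; exact: turns_ge0.
set Bt := board_after B h t in Bn Bt0 *.
have n0 : #|` Bt|%:R != 0 :> R by rewrite pnatr_eq0 cardfs_eq0.
under eq_big_seq => c cB.
  have chB : board_after B (extend t h c) t.+1 = chomp Bt c.
    by rewrite /= board_after_extend // /extend ltnn.
  rewrite IH; last 2 first.
  - by rewrite chB (leq_trans (card_chomp_lt cB)).
  - move=> s st; rewrite board_after_extend //.
    by move: st; rewrite ltnS leq_eqVlt => /orP[/eqP->|/before].
  rewrite chB (prob_past_extend hX cB) -/Bt.
  rewrite -(fineK (fin_num_measure P _ mp)) -!EFinM.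
  over.
rewrite -[in RHS](fineK (fin_num_measure P _ mp)) -EFinM sumEFin.
(* The turn just played turns [t] into [t.+1], which cancels the average loss of 1 in the harmonic
   sum. *)
congr EFin; rewrite -mulr_sumr big_split /= sum_harmonic_chomp; last first.
  exact: chomp_board_after.
rewrite sumr_fset_const -[_ *+ #|` Bt|]mulr_natl -mulrDr mulrA mulfVK //.
by rewrite -natr1 addrACA subrr addr0.
Qed.

End Measure.

Theorem theorem1 (R : realType) (d : measure_display)
    (Omega : measurableType d) (P : probability Omega R)
    (B : {fset cell}) (X : nat -> {RV P >-> cell})
    (hB : chomp_board B) (hX : random_chomp B X) :
  expected_turns B X = (\sum_(c <- B) (c.1%:R * c.2%:R)^-1)%:E /\
  (forall m n : nat, B = rectangle m n ->
     expected_turns B X =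
       ((\sum_(1 <= j < m.+1) j%:R^-1) * (\sum_(1 <= j < n.+1) j%:R^-1))%:E).
Proof.
have main : expected_turns B X = (\sum_(c <- B) (c.1%:R * c.2%:R)^-1)%:E.
  (* At time 0 the history is arbitrary: no entry is read and its event is the whole space. *)
  have := @integral_past_turns _ _ _ _ X B 0 (fun=> (0%N, 0%N)) hB hX.
  rewrite (_ : past X 0 _ = setT); last by apply/seteqP; split.
  by rewrite probability_setT mul1e add0r; apply.
split=> // m n Brect; rewrite main Brect big_rectangle; congr EFin.
rewrite mulr_suml; apply: eq_bigr => x _; rewrite mulr_sumr.
by apply: eq_bigr => y _; rewrite invfM.
Qed.
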